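(* Let $a,b,c$ be distinct vertices of $V$, and suppose the transition probabilities satisfy $p(b,a)=p(c,a)=1$ with $d(b)=d(c)=1$ and $b^{(1)}=c^{(1)}=a$. Let $h(v):=\mathbb{P}_v(T_b<T_c)$ for $v\in V$. Suppose that the quantity $$K_1:=1+\frac12\sum_{u\in V\setminus\{b,c\},\ v\in V} d(u)\,p(u,v)\,|h(u)-h(v)|$$ is finite. Then for any rotor walk $x_0,x_1,\ldots$ associated with this chain and rotor mechanism (any initial vertex and any initial rotor configuration), and all $t$ with $n_t(b)+n_t(c)>0$, $$\left| h(a)-\frac{n_t(b)}{n_t(b)+n_t(c)} \right|\leq \frac{K_1}{n_t(b)+n_t(c)}.$$
   Context: Markov chain: $V$ is a countable set (of vertices) and $p:V\times V\to[0,1]$ are the transition probabilities of a Markov chain $X_0,X_1,\ldots$ on $V$; all $p(u,v)$ are rational, and for each $u$ there are only finitely many $v$ with $p(u,v)>0$. $\mathbb{P}_u$ is the law of the chain started at $X_0=u$. $T_v:=\min\{t\ge 0: X_t=v\}$, with $\min\emptyset:=\infty$. Rotor mechanism: to each vertex $u$ are associated a positive integer $d(u)$ and a finite sequence of (not necessarily distinct) vertices $u^{(1)},\ldots,u^{(d(u))}$ (the successors of $u$) such that $p(u,v)=\#\{i:u^{(i)}=v\}/d(u)$ for all $u,v\in V$. Rotor walk: a rotor configuration is a map $r$ assigning to each $v\in V$ an integer $r(v)\in\{1,\ldots,d(v)\}$. Given an initial vertex $x_0$ and an initial rotor configuration $r_0$, the rotor walk is defined inductively: $r_{t+1}(v)=r_t(v)$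 for $v\ne x_t$; $r_{t+1}(x_t)=r_t(x_t)+1$ if $r_t(x_t)<d(x_t)$ and $r_{t+1}(x_t)=1$ if $r_t(x_t)=d(x_t)$; and $x_{t+1}:=(x_t)^{(r_{t+1}(x_t))}$. $n_t(v):=\#\{s\in\{0,\ldots,t-1\}: x_s=v\}$. (The condition $p(b,a)=p(c,a)=1$ may be imposed on any given chain by modifying the transitions out of $b$ and $c$; this does not change $h$.) *)

(* Defs.v *)
From HB Require Import structures.
From mathcomp Require Import all_boot all_order all_algebra.
From mathcomp Require Import all_classical all_reals all_analysis.

Set Implicit Arguments.
Unset Strict Implicit.
Unset Printing Implicit Defensive.

Import Order.TTheory GRing.Theory Num.Theory.

Local Open Scope classical_set_scope.
Local Open Scope ring_scope.

Section MarkovChain.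
Context {R : realType} {V : countType}.

Record is_transition (p : V -> V -> R) : Prop := IsTransition {
  transition_itv : forall u v, 0 <= p u v <= 1;
  transition_sum : forall u, (\esum_(v in [set: V]) (p u v)%:E = 1)%E;
  transition_rat : forall u v, exists q : rat, p u v = ratr q;
  transition_fin : forall u, finite_set [set v | 0 < p u v] }.

Context {disp : measure_display} {Omega : measurableType disp}.

(* The process X is a Markov chain with transition probabilities p, started at
   u, under each P u.  The Markov property
     P_u(X_(n+1) = x_(n+1) | X_0 = x_0, ..., X_n = x_n) = p(x_n, x_(n+1))
   is multiplied by the probability of the conditioning event, so that null
   conditioning events need no side condition. *)
Record is_markov_chain (p : V -> V -> R) (P : V -> probability Omega R)
    (X : nat -> Omega -> V) : Prop := IsMarkovChain {
  chain_measurable : forall n v, measurable [set w | X n w = v];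
  chain_init : forall u, P u [set w | X 0%N w = u] = 1%E;
  chain_step : forall u n (x : nat -> V),
    P u [set w | forall i, (i <= n.+1)%N -> X i w = x i] =
    (P u [set w | forall i, (i <= n)%N -> X i w = x i] *
      (p (x n) (x n.+1))%:E)%E }.

Definition hitting_time (X : nat -> Omega -> V) (v : V) (w : Omega) : \bar R :=
  if pselect (exists t, X t w == v) is left e then ((ex_minn e)%:R)%:E
  else +oo%E.

Definition hit_before (P : V -> probability Omega R) (X : nat -> Omega -> V)
    (b c v : V) : R :=
  fine (P v [set w | (hitting_time X b w < hitting_time X c w)%E]).

Definition K1 (d : V -> nat) (p : V -> V -> R) (h : V -> R) (b c : V) : \bar R :=
  (1 + (2^-1)%:E *
    \esum_(uv in [set uv : V * V | uv.1 <> b /\ uv.1 <> c])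
      ((d uv.1)%:R * p uv.1 uv.2 * `|h uv.1 - h uv.2|)%:E)%E.

End MarkovChain.

Section RotorWalk.
Context {V : countType} (d : V -> nat) (succ : forall u : V, (d u).-tuple V).

(* Rotor positions and successors are numbered from 1 to d u. *)
Definition successor (u : V) (i : nat) : V := nth u (succ u) i.-1.

Definition is_rotor_mechanism {R : realType} (p : V -> V -> R) : Prop :=
  forall u, (0 < d u)%N /\
    forall v,
      p u v = #|[pred i : 'I_(d u) | successor u i.+1 == v]|%:R / (d u)%:R.

Definition is_rotor_config (r : V -> nat) : Prop :=
  forall v, (1 <= r v <= d v)%N.

Definition rotor_incr (u : V) (k : nat) : nat :=
  if (k < d u)%N then k.+1 else 1%N.

Definition rotor_step (s : V * (V -> nat)) : V * (V -> nat) :=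
  let r' := fun v => if v == s.1 then rotor_incr v (s.2 v) else s.2 v in
  (successor s.1 (r' s.1), r').

Definition rotor_walk (x0 : V) (r0 : V -> nat) (t : nat) : V :=
  (iter t rotor_step (x0, r0)).1.

End RotorWalk.

Definition visits {V : countType} (x : nat -> V) (t : nat) (v : V) : nat :=
  #|[pred s : 'I_t | x s == v]|.

(* Main.v *)
Require Import Defs.
From HB Require Import structures.
From mathcomp Require Import all_boot all_order all_algebra.
From mathcomp Require Import all_classical all_reals all_analysis.
From mathcomp Require Import lra.

Set Implicit Arguments.
Unset Strict Implicit.
Unset Printing Implicit Defensive.

Import Order.TTheory GRing.Theory Num.Theory.
Local Open Scope classical_set_scope.
Local Open Scope ring_scope.

(** The function [h] is harmonic off [{b, c}], so over a full turn of the rotor at such a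
    vertex [u] the terms [h u - h (u^(i))] sum to [0].
    Hence [h (x_t)] plus the sum over [u] of the partial sums up to the current
    rotor position is conserved by every rotor step out of a vertex other than
    [b] and [c]; a step out of [b] adds [h a - 1] and one out of [c] adds [h a].
    So [(n b + n c) * h a - n b] is the total change of this potential, and
    [K1] bounds it: [1] for the first term and, since a partial sum of a
    vanishing sum is at most half of the sum of the absolute values, half of
    [sum_i |h u - h (u^(i))|] for each [u]. *)

(** * Hitting probabilities as series over the exit time *)

Section HittingProbability.
Context {R : realType} {V : countType} {disp : measure_display}
  {Omega : measurableType disp}.

Lemma measurable_mem_fiber (Y : Omega -> V) (s : seq V) :
  (forall v, measurable [set w | Y w = v]) -> measurable [set w | Y w \in s].
Proof.
move=> mY; elim: s => [|v s IHs].
  by rewrite (_ : mkset _ = set0)//; apply/seteqP; split.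
rewrite (_ : mkset _ = [set w | Y w = v] `|` [set w | Y w \in s]).
  exact: measurableU.
apply/seteqP; split => w /=; rewrite inE.
  by case/orP=> [/eqP|]; [left|right].
by case=> [->|->]; rewrite ?eqxx ?orbT.
Qed.

Lemma measure_setI_mem_fiber (mu : probability Omega R)
    (Y : Omega -> V) (A : set Omega) (s : seq V) :
  (forall v, measurable [set w | Y w = v]) -> measurable A -> uniq s ->
  mu (A `&` [set w | Y w \in s]) = (\sum_(v <- s) mu (A `&` [set w | Y w = v]))%E.
Proof.
move=> mY mA; elim: s => [_|v s IHs /= /andP[vs us]].
  by rewrite big_nil (_ : mkset _ = set0) ?setI0 ?measure0//; apply/seteqP; split.
rewrite (_ : _ `&` _ =
    (A `&` [set w | Y w = v]) `|` (A `&` [set w | Y w \in s])); last first.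
  apply/seteqP; split => w /=; rewrite inE.
    by case=> Aw /orP[/eqP|]; [left|right].
  by case=> -[Aw ->]; rewrite ?eqxx ?orbT.
rewrite big_cons -IHs// measureU//.
- exact: measurableI.
- by apply: measurableI => //; exact: measurable_mem_fiber.
- apply/seteqP; split => w //= [[_ Yv] [_]].
  by rewrite Yv (negbTE vs).
Qed.

Context (p : V -> V -> R) (P : V -> probability Omega R) (X : nat -> Omega -> V)
  (b c : V) (S : V -> seq V).

Definition cylinder (x : nat -> V) (k : nat) : set Omega :=
  [set w | forall i, (i <= k)%N -> X i w = x i].

(** From time [k] on, the chain first meets [{b, c}] after exactly [n] steps, and meets it at [b].
    The recursion advances the starting time, in step with the first-step analysis in
    [exit_prob]. *)
Fixpoint exit_at (n k : nat) : set Omega :=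
  if n is m.+1 then [set w | X k w \notin [:: b; c]] `&` exit_at m k.+1
  else [set w | X k w = b].

Fixpoint exit_prob (n : nat) (v : V) : R :=
  if n is m.+1 then
    if v \in [:: b; c] then 0 else \sum_(u <- S v) p v u * exit_prob m u
  else (v == b)%:R.

Hypothesis chainX : is_markov_chain p P X.
Hypothesis p_ge0 : forall u v, 0 <= p u v.
Hypothesis uniqS : forall v, uniq (S v).
(* Together with nonnegativity and total mass one, this makes S v contain the
   support of p v. *)
Hypothesis sumS : forall v, \sum_(u <- S v) p v u = 1.

Let mX n v : measurable [set w | X n w = v].
Proof. exact: (chain_measurable chainX). Qed.

Lemma cylinderS x k :
  cylinder x k.+1 = cylinder x k `&` [set w | X k.+1 w = x k.+1].
Proof.
apply/seteqP; split => w /=.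
  by move=> Cw; split; [move=> i ik; apply: Cw; exact: leqW | exact: Cw].
by move=> [Cw Xw] i; rewrite leq_eqVlt => /orP[/eqP->//|]; exact: Cw.
Qed.

Lemma measurable_cylinder x k : measurable (cylinder x k).
Proof.
elim: k => [|k IHk]; last by rewrite cylinderS; exact: measurableI.
rewrite (_ : cylinder _ _ = [set w | X 0%N w = x 0%N])//.
apply/seteqP; split => w /=; first exact.
by move=> Xw i; rewrite leqn0 => /eqP->.
Qed.

Lemma measurable_exit_at n k : measurable (exit_at n k).
Proof.
elim: n k => [|n IHn] k //=; apply: measurableI => //.
rewrite (_ : mkset _ =
    ~` ([set w | X k w = b] `|` [set w | X k w = c])); last first.
  apply/seteqP; split => w /=; rewrite !inE negb_or.
    by move=> /andP[/eqP Xb /eqP Xc] [].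
  by move=> H; apply/andP; split; apply/eqP => E; apply: H; [left|right].
by apply: measurableC; exact: measurableU.
Qed.

Lemma exit_prob_ge0 n v : 0 <= exit_prob n v.
Proof.
elim: n v => [|n IHn] v /=; first exact: ler0n.
by case: ifP => // _; apply: sumr_ge0 => u _; exact: mulr_ge0.
Qed.

Lemma cylinder_next u x k v :
  P u (cylinder x k `&` [set w | X k.+1 w = v]) =
  (P u (cylinder x k) * (p (x k) v)%:E)%E.
Proof.
(* The Markov property is stated along a path, so the path is redirected to [v] at time [k.+1]. *)
pose y i := if i == k.+1 then v else x i.
have yk : y k = x k by rewrite /y ltn_eqF.
have ykS : y k.+1 = v by rewrite /y eqxx.
have Cy : cylinder y k = cylinder x k.
  by apply/seteqP; split => w /= Cw i ik; rewrite Cw// /y ltn_eqF.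
by have := chain_step chainX u k y; rewrite -!/(cylinder _ _) cylinderS Cy yk ykS.
Qed.

(** The probabilities of stepping from [x k] into [S (x k)] add up to 1, so no mass is left outside.
    One-step decompositions thus become finite sums although [V] may be infinite. *)
Lemma cylinder_next_null u x k :
  P u (cylinder x k `\` [set w | X k.+1 w \in S (x k)]) = 0%E.
Proof.
have mC := measurable_cylinder x k.
have mF := measurable_mem_fiber (S (x k)) (mX k.+1).
have fC := fin_num_measure (P u) _ mC.
have -> : P u (cylinder x k `\` [set w | X k.+1 w \in S (x k)]) =
    (P u (cylinder x k) -
     P u (cylinder x k `&` [set w | X k.+1 w \in S (x k)]))%E.
  by apply: measureD; rewrite // ltey_eq fC.
rewrite (measure_setI_mem_fiber _ (mX k.+1) mC (uniqS (x k))).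
under eq_bigr do rewrite cylinder_next.
rewrite -ge0_sume_distrr ?sumEFin ?sumS ?mule1 ?subee// => v _.
by rewrite lee_fin.
Qed.

(* Quantifying over all cylinders makes the induction on n go through one step
   of the chain at a time, from front to back, with no sum over paths. *)
Lemma exit_at_prob u n x k :
  P u (cylinder x k `&` exit_at n k) =
  (P u (cylinder x k) * (exit_prob n (x k))%:E)%E.
Proof.
elim: n x k => [|n IHn] x k /=.
  case: eqVneq => [xb|/eqP xb].
    rewrite mule1 setIidl// => w Cw /=; by rewrite Cw.
  rewrite mule0 (_ : _ `&` _ = set0) ?measure0//.
  by apply/seteqP; split => w //= [Cw]; rewrite Cw.
case: ifPn => [xbc|xbc].
  rewrite mule0 (_ : _ `&` _ = set0) ?measure0//.
  by apply/seteqP; split => w //= [Cw []]; rewrite Cw ?xbc.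
rewrite setIA (setIidl (A := cylinder x k)); last by move=> w /= ->.
have mC := measurable_cylinder x k.
have mE := measurable_exit_at n k.+1.
have mA : measurable (cylinder x k `&` exit_at n k.+1) by exact: measurableI.
have mF := measurable_mem_fiber (S (x k)) (mX k.+1).
(* Split on whether [X k.+1] lies in [S (x k)]: one part is null, the other a finite sum over the
   next vertex. *)
have -> : P u (cylinder x k `&` exit_at n k.+1) =
    (P u (cylinder x k `&` exit_at n k.+1 `\` [set w | X k.+1 w \in S (x k)]) +
     P u (cylinder x k `&` exit_at n k.+1 `&` [set w | X k.+1 w \in S (x k)]))%E.
  exact: measureDI.
have -> : P u (cylinder x k `&` exit_at n k.+1 `\`
    [set w | X k.+1 w \in S (x k)]) = 0%E.
  apply: (subset_measure0 _ _ _ (cylinder_next_null u x k)).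
  - exact: measurableD.
  - by apply: measurableD.
  - by apply: setSD => w [].
rewrite add0e (measure_setI_mem_fiber _ (mX k.+1) mA (uniqS (x k))).
rewrite -sumEFin ge0_sume_distrr; last first.
  by move=> v _; rewrite lee_fin mulr_ge0// exit_prob_ge0.
apply: eq_bigr => v _.
pose y i := if i == k.+1 then v else x i.
have yk : y k = x k by rewrite /y ltn_eqF.
have ykS : y k.+1 = v by rewrite /y eqxx.
have Cy : cylinder y k = cylinder x k.
  by apply/seteqP; split => w /= Cw i ik; rewrite Cw// /y ltn_eqF.
have := IHn y k.+1.
rewrite cylinderS Cy ykS cylinder_next EFinM muleA => <-.
by rewrite setIAC.
Qed.

Lemma exit_atE n k w :
  exit_at n k w <->
  X (k + n)%N w = b /\ forall i, (i < n)%N -> X (k + i)%N w \notin [:: b; c].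
Proof.
elim: n k => [|n IHn] k /=; first by rewrite addn0; split => [|[]].
rewrite IHn addSnnS; split => [[Xk [Xb Xi]]|[Xb Xi]].
  by split => // -[_|i]; [rewrite addn0|rewrite ltnS addnS -addSn; exact: Xi].
split; first by have := Xi 0%N isT; rewrite addn0.
by split => // i ni; rewrite addSnnS; exact: Xi.
Qed.

Lemma exit_at_uniq n m w : exit_at n 0 w -> exit_at m 0 w -> n = m.
Proof.
move=> /exit_atE[Xn Xi] /exit_atE[Xm Xj].
case: (ltngtP n m) => // [/Xj|/Xi]; first by rewrite Xn inE eqxx.
by rewrite Xm inE eqxx.
Qed.

Hypothesis bc : b <> c.

(** The index [n] is the hitting time of [b]: an earlier visit to [b] contradicts minimality, and
    one to [c] contradicts the order. Conversely, the hitting time of [c] cannot equal [n] because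
    [b] and [c] differ. *)
Lemma hit_beforeP :
  [set w | (hitting_time X b w < hitting_time X c w :> \bar R)%E] =
  \bigcup_n exit_at n 0.
Proof.
apply/seteqP; split => w /=; rewrite /hitting_time.
  case: pselect => [eb|_]; last by rewrite ltNge leey.
  case: (ex_minnP eb) => n /eqP Xn minn lt_bc.
  exists n => //; apply/exit_atE; split => // i ltin.
  rewrite !inE negb_or; apply/andP; split; apply/negP => Xi.
    by have := minn _ Xi; rewrite leqNgt ltin.
  move: lt_bc; case: pselect => [ec|]; last by case; exists i.
  case: (ex_minnP ec) => m _ /(_ _ Xi) lemi.
  by rewrite lte_fin ltr_nat ltnNge (leq_trans lemi)// ltnW.
move=> [n _ /exit_atE[/eqP Xn Xi]].
case: pselect => [eb|]; last by case; exists n.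
case: (ex_minnP eb) => m _ /(_ _ Xn) lemn.
case: pselect => [ec|_]; last exact: ltry.
case: (ex_minnP ec) => k Xk _; rewrite lte_fin ltr_nat (leq_ltn_trans lemn)//.
rewrite ltnNge leq_eqVlt; apply/negP => /orP[/eqP kn|/Xi].
  by apply: bc; rewrite -(eqP Xn) -(eqP Xk) kn.
by rewrite !inE Xk orbT.
Qed.

Lemma measurable_hit_before :
  measurable [set w | (hitting_time X b w < hitting_time X c w :> \bar R)%E].
Proof.
by rewrite hit_beforeP; apply: bigcupT_measurable => n; exact: measurable_exit_at.
Qed.

Lemma hit_before_itv01 u : 0 <= hit_before P X b c u <= 1.
Proof.
rewrite /hit_before fine_ge0//= -lee_fin fineK.
  exact/probability_le1/measurable_hit_before.
exact/fin_num_measure/measurable_hit_before.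
Qed.

Lemma hit_before_series u :
  ((hit_before P X b c u)%:E = \sum_(0 <= n <oo) (exit_prob n u)%:E)%E.
Proof.
rewrite /hit_before fineK; last exact/fin_num_measure/measurable_hit_before.
rewrite hit_beforeP measure_semi_bigcup.
- apply: eq_eseriesr => n _; transitivity (P u (exit_at n 0)); first by [].
  have C0 : cylinder (fun=> u) 0 = [set w | X 0%N w = u].
    apply/seteqP; split => w /=; first exact.
    by move=> Xu i; rewrite leqn0 => /eqP->.
  have P0 : P u (cylinder (fun=> u) 0) = 1%E.
    by rewrite C0; exact: chain_init chainX u.
  have := exit_at_prob u n (fun=> u) 0; rewrite P0 mul1e => <-.
  have mC := measurable_cylinder (fun=> u) 0.
  have mE := measurable_exit_at n 0.
  (* Since [X 0 = u] holds almost surely under [P u], intersecting with this cylinder keeps the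
     probability and makes [exit_at_prob] applicable. *)
  have -> : P u (exit_at n 0) =
      (P u (exit_at n 0 `\` cylinder (fun=> u) 0) +
       P u (exit_at n 0 `&` cylinder (fun=> u) 0))%E by exact: measureDI.
  have null : P u (~` cylinder (fun=> u) 0) = 0%E.
    by rewrite probability_setC// P0 subee.
  have -> : P u (exit_at n 0 `\` cylinder (fun=> u) 0) = 0%E.
    apply: (subset_measure0 _ _ _ null).
    - exact: measurableD.
    - exact: measurableC.
    - by move=> w [].
  by rewrite add0e setIC.
- by move=> n; exact: measurable_exit_at.
- by apply/trivIsetP => i j _ _ /eqP ij; apply/seteqP; split => w //= [/exit_at_uniq h /h].
- by apply: bigcupT_measurable => n; exact: measurable_exit_at.
Qed.

Lemma hit_before_target : hit_before P X b c b = 1.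
Proof.
apply: EFin_inj; rewrite hit_before_series nneseries_recl//.
  rewrite eseries0 ?adde0/= ?eqxx// => -[|n]//= _ _.
  by rewrite inE eqxx.
by move=> n _; rewrite lee_fin exit_prob_ge0.
Qed.

Lemma hit_before_avoid : hit_before P X b c c = 0.
Proof.
apply: EFin_inj; rewrite hit_before_series eseries0// => -[|n] _ _ /=.
  by case: eqVneq => // cb; case: bc.
by rewrite !inE eqxx orbT.
Qed.

(** The term [n = 0] of the series vanishes because [u] is not [b]. In each later term the recursion
    of [exit_prob] takes out one step, and nonnegativity lets the finite sum be exchanged with the
    series. *)
Lemma hit_before_harmonic u : u \notin [:: b; c] ->
  hit_before P X b c u = \sum_(v <- S u) p u v * hit_before P X b c v.
Proof.
move=> ubc; have ge0 n v : (0 <= (exit_prob n v)%:E)%E.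
  by rewrite lee_fin exit_prob_ge0.
apply: EFin_inj; rewrite hit_before_series nneseries_recl//.
move: (ubc); rewrite inE negb_or => /andP[/negbTE ub _].
rewrite [exit_prob 0 u]/= ub add0e -nneseries_addn//.
under eq_eseriesr.
  move=> n _; rewrite addn1 /= (negbTE ubc) -sumEFin.
  over.
rewrite nneseries_sum => [|v n _]; last first.
  by rewrite EFinM mule_ge0// lee_fin.
rewrite -sumEFin; apply: eq_bigr => v _.
under eq_eseriesr do rewrite EFinM.
by rewrite nneseriesZl// EFinM hit_before_series.
Qed.

End HittingProbability.

(** * The rotor potential and its conservation along the walk *)

Section RotorWalkPotential.
Context {R : realType} {V : countType} (d : V -> nat)
  (succ : forall u : V, (d u).-tuple V).

Lemma visitsS (x : nat -> V) (t : nat) (v : V) :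
  visits x t.+1 v = (visits x t v + (x t == v))%N.
Proof.
rewrite /visits -!sum1_card big_mkcond big_ord_recr/= inE [in RHS]big_mkcond.
by congr (_ + _)%N; case: eqP.
Qed.

(** Double counting: [d u * p u v] is the multiplicity of [v] among the successors of [u]. *)
Lemma sum_transition (p : V -> V -> R) (g : V -> R) (u : V) :
  is_rotor_mechanism succ p ->
  \sum_(v <- undup (succ u)) (d u)%:R * p u v * g v =
  \sum_(0 <= i < d u) g (successor succ u i.+1).
Proof.
move=> /(_ u)[du0 pE]; rewrite big_mkord.
have -> : \sum_(i < d u) g (successor succ u i.+1) =
    \sum_(i < d u) \sum_(v <- undup (succ u) | v == successor succ u i.+1) g v.
  apply: eq_bigr => i _; rewrite -big_filter filter_pred1_uniq ?undup_uniq//.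
    by rewrite big_seq1.
  by rewrite mem_undup; apply: mem_nth; rewrite size_tuple; exact: ltn_ord.
rewrite (exchange_big_dep predT)//=; apply: eq_bigr => v _.
rewrite pE mulrCA divff ?pnatr_eq0 ?gtn_eqF// mulr1.
rewrite sumr_const mulr_natl; congr (_ *+ _).
by apply: eq_card => i; rewrite !inE eq_sym.
Qed.

(** The block [B] between the two positions is minus the sum of the outer blocks [A] and [C], so
    [2 |B| <= |A| + |B| + |C|]. Hence the factor 1/2 in [K1]. *)
Lemma normr_sum_diff_le (F : nat -> R) (m i j : nat) :
  \sum_(0 <= k < m) F k = 0 -> (i <= m)%N -> (j <= m)%N ->
  `|\sum_(0 <= k < j) F k - \sum_(0 <= k < i) F k| <=
  2^-1 * \sum_(0 <= k < m) `|F k|.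
Proof.
move=> F0; wlog ij : i j / (i <= j)%N => [hw im jm|im jm].
  by case: (leqP i j) => [|/ltnW] ij; [|rewrite distrC]; apply: hw.
have split3 (G : nat -> R) : \sum_(0 <= k < m) G k =
    \sum_(0 <= k < i) G k + \sum_(i <= k < j) G k + \sum_(j <= k < m) G k.
  by rewrite -!big_cat_nat.
have cat_ij : \sum_(0 <= k < j) F k = \sum_(0 <= k < i) F k + \sum_(i <= k < j) F k.
  by rewrite -big_cat_nat.
move: F0; rewrite !split3 cat_ij => F0.
rewrite [X in `|X|]addrAC subrr add0r.
have := ler_norm_sum (index_iota 0 i) F xpredT.
have := ler_norm_sum (index_iota i j) F xpredT.
have := ler_norm_sum (index_iota j m) F xpredT.
set A := \sum_(0 <= k < i) F k in F0 *; set B := \sum_(i <= k < j) F k in F0 *.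
set C := \sum_(j <= k < m) F k in F0 * => leC leB leA.
have : `|B| <= `|A| + `|C|.
  rewrite (_ : B = - (A + C)) ?normrN ?ler_normD//; lra.
lra.
Qed.

Context (h : V -> R).

(* Vanishing at j = d u is harmonicity of h at u. *)
Definition rotor_potential (u : V) (j : nat) : R :=
  \sum_(0 <= i < j) (h u - h (successor succ u i.+1)).

Lemma rotor_incr_bound u k : (0 < d u)%N -> (1 <= rotor_incr d u k <= d u)%N.
Proof. by rewrite /rotor_incr; case: ifP => // ->. Qed.

Lemma rotor_potential_incr u k : (0 < k <= d u)%N ->
  rotor_potential u (d u) = 0 ->
  rotor_potential u (rotor_incr d u k) - rotor_potential u k =
  h u - h (successor succ u (rotor_incr d u k)).
Proof.
move=> /andP[k0 kd] pot0; rewrite /rotor_incr; case: ltnP => dk.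
  by rewrite /rotor_potential big_nat_recr//= addrAC subrr add0r.
(* At [d u] the rotor wraps to 1: the potential passes from the vanishing full sum to its first
   term, so the increment has the same form. *)
have -> : k = d u by apply/eqP; rewrite eqn_leq kd.
by rewrite pot0 subr0 /rotor_potential big_nat1.
Qed.

Context (b c x0 : V) (r0 : V -> nat).

Local Notation state t := (iter t (rotor_step succ) (x0, r0)).
Local Notation x := (rotor_walk succ x0 r0).

Hypothesis d_gt0 : forall u, (0 < d u)%N.
Hypothesis config0 : is_rotor_config d r0.
Hypothesis bc : b != c.

Lemma state_config t : is_rotor_config d (state t).2.
Proof.
elim: t => //= t IHt v; case: ifP => // _; exact: rotor_incr_bound.
Qed.

(** Off [b] and [c], a step changes [h] and the potential by opposite amounts. Rotors outside [U]
    have not moved, so a finite sum captures the whole change. *)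
Lemma rotor_walk_conservation (U : seq V) (t : nat) :
  (forall u, u != b -> u != c -> rotor_potential u (d u) = 0) ->
  d b = 1%N -> d c = 1%N -> uniq U -> (forall s, (s < t)%N -> x s \in U) ->
  h (x t) - h x0 + \sum_(u <- U | (u != b) && (u != c))
    (rotor_potential u ((state t).2 u) - rotor_potential u (r0 u)) =
  (visits x t b)%:R * (h (successor succ b 1) - h b) +
  (visits x t c)%:R * (h (successor succ c 1) - h c).
Proof.
move=> pot0 db dc uU; elim: t => [_|t IHt xU].
  rewrite subrr add0r /visits !eq_card0 ?mul0r ?addr0; try by case.
  by rewrite big1// => u _; rewrite subrr.
have {}IHt := IHt (fun s st => xU s (ltnW st)).
rewrite !visitsS !natrD !mulrDl addrACA -IHt.
set r := (state t).2 in IHt *; set r' := (state t.+1).2.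
have r'E v : r' v = if v == x t then rotor_incr d v (r v) else r v by [].
have xS : x t.+1 = successor succ (x t) (r' (x t)) by [].
have r'x : r' (x t) = rotor_incr d (x t) (r (x t)) by rewrite r'E eqxx.
have -> : \sum_(u <- U | (u != b) && (u != c))
      (rotor_potential u (r' u) - rotor_potential u (r0 u)) =
    \sum_(u <- U | (u != b) && (u != c))
      (rotor_potential u (r u) - rotor_potential u (r0 u)) +
    (if (x t != b) && (x t != c) then h (x t) - h (x t.+1) else 0).
  (* The one changed term becomes a sum over [U] concentrated at [x t], so that the two sides can be
     compared vertex by vertex. *)
  have -> : (if (x t != b) && (x t != c) then h (x t) - h (x t.+1) else 0) =
     \sum_(u <- U | u == x t)
       (if (u != b) && (u != c) then h (x t) - h (x t.+1) else 0).
    rewrite -big_filter filter_pred1_uniq ?big_seq1//; exact: xU.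
  rewrite big_mkcond [X in X + _]big_mkcond [X in _ + X]big_mkcond -big_split/=.
  apply: eq_bigr => u _; case: ifP => ubc; last by rewrite if_same addr0.
  case: eqVneq => [ux|ux]; last by rewrite addr0 r'E (negbTE ux).
  rewrite ux xS r'x -rotor_potential_incr; first by rewrite addrC addrA subrK.
    exact: state_config.
  by case/andP: ubc; rewrite ux; exact: pot0.
(* With a single successor the rotor always returns to position 1; this covers the steps out of [b]
   and [c]. *)
have r1 v : d v = 1%N -> rotor_incr d v (r v) = 1%N.
  by move=> dv; have := rotor_incr_bound (r v) (d_gt0 v); rewrite dv -eqn_leq => /eqP.
case: (eqVneq (x t) b) => [xb|xb] /=.
  rewrite xb (negbTE bc) xS r'x xb r1//; rewrite mulr0n; lra.
case: (eqVneq (x t) c) => [xc|xc] /=; last by lra.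
by rewrite xS r'x xc r1//; lra.
Qed.

End RotorWalkPotential.

(** * Comparison with [K1] and the discrepancy bound *)

Lemma K1_finite_le (R : realType) (V : countType) (d : V -> nat)
    (p : V -> V -> R) (h : V -> R) (b c : V) (S : V -> seq V) (U : seq V) :
  (forall u v, 0 <= p u v) -> (forall u, uniq (S u)) -> uniq U ->
  (K1 d p h b c < +oo)%E ->
  1 + 2^-1 * \sum_(u <- U | (u != b) && (u != c))
    \sum_(v <- S u) (d u)%:R * p u v * `|h u - h v| <= fine (K1 d p h b c).
Proof.
move=> p0 uS uU.
set I := [set uv : V * V | uv.1 <> b /\ uv.1 <> c].
pose f (uv : V * V) : \bar R :=
  ((d uv.1)%:R * p uv.1 uv.2 * `|h uv.1 - h uv.2|)%:E.
have f0 uv : (0 <= f uv)%E by rewrite lee_fin !mulr_ge0.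
rewrite -[K1 _ _ _ _ _]/(1 + (2^-1)%:E * \esum_(uv in I) f uv)%E => Kfin.
rewrite -lee_fin fineK; last first.
  by rewrite ge0_fin_numE// adde_ge0// mule_ge0// ?lee_fin ?invr_ge0// esum_ge0.
rewrite EFinD EFinM leeD2l// lee_pmul2l ?lte_fin ?invr_gt0 ?ltr0n//.
(* The index pairs of the finite double sum, without repetition; a sum of nonnegative terms over [I]
   dominates the one over [W]. *)
pose W := [seq (u, v) | u <- [seq u <- U | (u != b) && (u != c)], v <- S u].
have uW : uniq W.
  apply: allpairs_uniq_dep; rewrite ?filter_uniq//.
  by move=> [u v] [u' v'] _ _ /= [-> ->].
apply: esum_ge; exists [set` W].
  split; first exact: finite_seq.
  move=> _ /allpairsPdep[u [v [+ _ ->]]].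
  by rewrite mem_filter => /andP[/andP[/eqP ub /eqP uc] _].
rewrite -fsbig_seq// big_allpairs_dep/= -sumEFin big_filter.
by apply: lee_sum => u _; rewrite -sumEFin.
Qed.

Theorem theorem1 (R : realType) (V : countType)
    (disp : measure_display) (Omega : measurableType disp)
    (p : V -> V -> R) (P : V -> probability Omega R) (X : nat -> Omega -> V)
    (d : V -> nat) (succ : forall u : V, (d u).-tuple V)
    (a b c : V) (x0 : V) (r0 : V -> nat) (t : nat) :
  is_transition p ->
  is_markov_chain p P X ->
  is_rotor_mechanism succ p ->
  a <> b -> a <> c -> b <> c ->
  p b a = 1 -> p c a = 1 ->
  d b = 1%N -> d c = 1%N ->
  successor succ b 1 = a -> successor succ c 1 = a ->
  let h := hit_before P X b c in
  (K1 d p h b c < +oo)%E ->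
  is_rotor_config d r0 ->
  let n := visits (rotor_walk succ x0 r0) t in
  (0 < n b + n c)%N ->
  `| h a - (n b)%:R / (n b + n c)%:R | <= fine (K1 d p h b c) / (n b + n c)%:R.
Proof.
move=> trp chainX rotorP _ _ bc _ _ db dc sb sc h Kfin config0 n n_gt0.
have p0 u v : 0 <= p u v by case/andP: (transition_itv trp u v).
pose S u := undup (succ u).
have uS u : uniq (S u) by exact: undup_uniq.
have d0 u : (0 < d u)%N by case: (rotorP u).
have dn0 u : (d u)%:R != 0 :> R by rewrite pnatr_eq0 -lt0n.
have sumS u : \sum_(v <- S u) p u v = 1.
  (* After multiplication by [d u], the claim counts the rotor positions at [u]. *)
  apply: (mulfI (dn0 u)); rewrite mulr1 mulr_sumr.
  under eq_bigr do rewrite -[_ * _]mulr1.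
  by rewrite (sum_transition (fun=> 1) u rotorP) sumr_const_nat subn0.
have pot0 u : u != b -> u != c -> rotor_potential succ h u (d u) = 0.
  move=> ub uc; rewrite /rotor_potential sumrB sumr_const_nat subn0.
  rewrite -(sum_transition h u rotorP).
  have ubc : u \notin [:: b; c] by rewrite !inE negb_or ub.
  have hu : h u = \sum_(v <- S u) p u v * h v.
    exact: hit_before_harmonic chainX p0 uS sumS bc _ ubc.
  rewrite hu -[X in X - _]mulr_natl mulr_sumr -sumrB big1// => v _.
  by rewrite mulrA subrr.
pose x := rotor_walk succ x0 r0.
pose U := undup [seq x s | s <- iota 0 t].
have xU s : (s < t)%N -> x s \in U.
  by move=> st; rewrite mem_undup; apply: map_f; rewrite mem_iota.
have bc' : b != c by exact/eqP.
have := rotor_walk_conservation d0 config0 bc' pot0 db dc (undup_uniq _) xU.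
have hb : h b = 1 := hit_before_target chainX p0 uS sumS bc.
have hc : h c = 0 := hit_before_avoid chainX p0 uS sumS bc.
rewrite sb sc hb hc -/n subr0.
set D := \sum_(u <- U | _) _ => cons.
have h01 u : 0 <= h u <= 1 := hit_before_itv01 chainX bc u.
have hD : `|D| <= 2^-1 * \sum_(u <- U | (u != b) && (u != c))
    \sum_(v <- S u) (d u)%:R * p u v * `|h u - h v|.
  rewrite mulr_sumr (le_trans (ler_norm_sum _ _ _))//.
  apply: ler_sum => u /andP[ub uc].
  rewrite (sum_transition (fun v => `|h u - h v|) u rotorP).
  (* The current and initial rotor positions at [u] give two partial sums of the same vanishing
     sum. *)
  apply: normr_sum_diff_le; first exact: pot0.
    by case/andP: (config0 u).
  by case/andP: (state_config succ x0 d0 config0 t u).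
have := K1_finite_le p0 uS (undup_uniq _ : uniq U) Kfin.
have N0 : 0 < (n b + n c)%:R :> R by rewrite ltr0n.
have N1 := lt0r_neq0 N0.
move=> hK; rewrite ler_pdivlMr// -{2}(gtr0_norm N0) -normrM mulrBl divfK//.
have /andP[??] := h01 (x t); have /andP[??] := h01 x0.
(* This accounts for the summand 1 of [K1]. *)
have : `|h (x t) - h x0| <= 1 by rewrite ler_norml; lra.
(* The left side equals [n b * (h a - 1) + n c * h a], which conservation identifies with the total
   change. *)
move=> hx; rewrite (_ : _ - _ = h (x t) - h x0 + D); last first.
  by rewrite cons natrD; lra.
rewrite (le_trans (ler_normD _ _))//; lra.
Qed.
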